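(* Every subcubic graph $G$ with $\mathrm{mad}(G)<\frac{30}{11}$ is packing $(1,1,2,2)$-colorable.
   Context: Graphs are finite and simple. A graph is subcubic if its maximum degree is at most $3$. The maximum average degree of $G$ is $\mathrm{mad}(G)=\max\{\frac{2|E(H)|}{|V(H)|} : H\subseteq G\}$, the maximum being over subgraphs $H$ with at least one vertex. For a non-decreasing sequence of positive integers $S=(s_1,\dots,s_k)$, a packing $S$-coloring of $G$ is a partition of $V(G)$ into (possibly empty) sets $V_1,\dots,V_k$ such that for each $1\le i\le k$ the distance in $G$ between any two distinct $x,y\in V_i$ is at least $s_i+1$ (vertices in different components are at infinite distance). $G$ is packing $S$-colorable if it has a packing $S$-coloring. *)

(* Defs.v *)
From HB Require Import structures.
From mathcomp Require Import all_boot all_order all_algebra.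

Set Implicit Arguments.
Unset Strict Implicit.
Unset Printing Implicit Defensive.

Import Order.TTheory GRing.Theory Num.Theory.

(* A finite simple graph is a symmetric irreflexive adjacency relation [e] on *)
(* a finType; the two properties are hypotheses wherever they are needed.     *)

Definition degree (T : finType) (e : rel T) (x : T) : nat := #|[set y | e x y]|.

Definition subcubic (T : finType) (e : rel T) : Prop :=
  forall x : T, degree e x <= 3.

Definition edges (T : finType) (e : rel T) : {set {set T}} :=
  [set [set p.1; p.2] | p : T * T & e p.1 p.2].

(* A subgraph is a pair (vertex set, edge set), not necessarily induced. *)
Definition is_subgraph (T : finType) (e : rel T)
    (H : {set T} * {set {set T}}) : bool :=
  (H.2 \subset edges e) && [forall A in H.2, A \subset H.1].

(* All the averages are nonnegative, so the unit 0 of the iterated maximum    *)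
(* only shows for the graph without vertices, whose mad is 0 by convention.   *)
Definition mad (T : finType) (e : rel T) : rat :=
  (\big[Num.max/0]_(H : {set T} * {set {set T}} |
       is_subgraph e H && (H.1 != set0))
     ((2 * #|H.2|)%:R / #|H.1|%:R))%R.

Definition walk_of_length (T : finType) (e : rel T) (x y : T) (n : nat) : bool :=
  [exists p : n.-tuple T, path e x p && (last x p == y)].

(* [None] is the infinite distance. A shortest walk repeats no vertex, hence  *)
(* has length less than #|T|, so [find] does return the least length.         *)
Definition dist (T : finType) (e : rel T) (x y : T) : option nat :=
  if connect e x y then Some (find (walk_of_length e x y) (iota 0 #|T|))
  else None.

Definition dist_geq (d : option nat) (n : nat) : bool :=
  if d is Some m then n <= m else true.

(* The partition into possibly empty classes V_i is given by the map sending  *)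
(* a vertex to the index of its class; indices start at 0.                    *)
Definition is_packing_coloring (T : finType) (e : rel T) (k : nat)
    (S : k.-tuple nat) (c : {ffun T -> 'I_k}) : Prop :=
  forall (i : 'I_k) (x y : T), c x = i -> c y = i -> x != y ->
    dist_geq (dist e x y) (tnth S i).+1.

Definition packing_colorable (T : finType) (e : rel T) (k : nat)
    (S : k.-tuple nat) : Prop :=
  exists c : {ffun T -> 'I_k}, is_packing_coloring e S c.

(* Main.v *)
Require Import Defs.
From HB Require Import structures.
From mathcomp Require Import all_boot all_order all_algebra.
From mathcomp Require Import zify.

Set Implicit Arguments.
Unset Strict Implicit.
Unset Printing Implicit Defensive.

Import Order.TTheory GRing.Theory Num.Theory.

(** A minimal counterexample is reduced to four configurations, and a count of
    edges shows that a graph without them is too dense.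

    Call the colors of the first two classes near (they only have to form
    independent sets) and those of the last two far (at distance at least 3).
    Let D be a smallest set of vertices whose induced subgraph has no coloring.
    A vertex of D has degree 2 or 3 in D, no two 2-vertices are adjacent, and a
    vertex has at most one 2-vertex among its neighbours.  The decisive fact is
    [no_spider]: a 3-vertex x with a 2-neighbour has at most one neighbour of
    degree 3 that itself has a 2-neighbour.  Call a 3-vertex close if it has a
    2-neighbour and distant otherwise.  There are two close vertices for each
    2-vertex, and every close vertex has a distant neighbour, so that there are
    at most three close vertices for each distant one.  With n2 and n3 the
    numbers of 2- and 3-vertices this gives 3 * n3 >= 8 * n2, that is, an
    average degree of at least 30/11 ([dense]).

    All four configurations are excluded in one way ([colorable_of_reducible]).
    Remove a set S of vertices, each of which has at most one neighbour outside
    S.  The vertices left over then gain no new pair at distance 2 when S is put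
    back, so a coloring of D minus S remains good there.  Take one in which no
    far vertex can be recolored near: then each far vertex sees both near
    colors.  What S has to know about an outer neighbour w is one of seven
    traces.  If w is near and some far color is missing around w, the vertex of
    S next to w may use that far color or the near color opposite to w.  If w is
    near and sees both far colors, then its neighbours outside S are exactly
    two far vertices, so w can switch its near color at will, and the vertex of
    S may use either near color.  If w is far, then its neighbours outside S
    are near, and it forbids its own color at distance at most 2.  Whether S can
    be colored against all traces is a finite question about a graph on at most
    six vertices, settled by computation ([extendable], [extendable_sound]).
    Two vertices of S may have the same outer neighbour; since that vertex has
    degree at most 3 its trace is then of the first kind, and the search runs
    over these coincidences too. *)

(** * A finite search for colorings of a small graph *)

(** The first component tells the far colors from the near ones. *)
Definition color : finType := (bool * bool)%type.
Definition near (i : bool) : color := (false, i).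
Definition far (j : bool) : color := (true, j).
Definition palette : seq color := [:: near false; near true; far false; far true].

(** What a vertex of the removed set must know about its neighbour w outside:
    - [Free]: there is no such neighbour;
    - [Strict i j]: w has the near color other than i and no neighbour of w
      outside has the far color j;
    - [Flip]: w is near and sees both far colors, so it can be recolored;
    - [Far j]: w has the far color j, and only near neighbours outside. *)
Inductive trace := Free | Strict of bool & bool | Flip | Far of bool.

Lemma trace_comparable : comparable trace.
Proof. by move=> t t'; rewrite /decidable; repeat decide equality. Defined.
HB.instance Definition _ := hasDecEq.Build trace (compareP trace_comparable).

Definition strict (t : trace) := if t is Strict _ _ then true else false.

Definition allows (t : trace) (k : color) : bool :=
  match t with
  | Free => true
  | Strict i j => if k.1 then k.2 == j else k.2 == i
  | Flip => ~~ k.1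
  | Far j => k != far j
  end.

(** A far outer neighbour is at distance 2 from the inner neighbours of the
    vertex carrying the trace, and so restricts those as well. *)
Definition bars (t : trace) (k : color) : bool :=
  if t is Far j then k == far j else false.

Definition outer_traces : seq trace :=
  [:: Strict false false; Strict false true; Strict true false;
      Strict true true; Flip; Far false; Far true].

Lemma outer_traces_all t : t != Free -> t \in outer_traces.
Proof. by case: t => [|[] []||[]]. Qed.

(** How a vertex relates to an earlier one: adjacent, with a common neighbour in
    the set, allowed to have the same neighbour outside. *)
Definition link := (bool * bool * bool)%type.

(** The number identifies the outer neighbour: equal numbers mean that it is
    shared. *)
Definition entry := (nat * trace)%type.

Definition compatible (l : link) (x : entry) (k : color) (y : entry) (k' : color) :=
  (l.1.1 ==> [&& k != k', ~~ bars x.2 k' & ~~ bars y.2 k]) &&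
  (k.1 && (l.1.2 || (x.1 == y.1)) ==> (k != k')).

(** A new vertex either has an outer neighbour of its own, with an arbitrary
    trace, or shares the outer neighbour of an earlier vertex, which is possible
    for [Strict] traces only and has to be allowed for all vertices that share
    it already.  The unused number [size env] marks a fresh neighbour. *)
Definition entries (outer : bool) (ls : seq link) (env : seq entry) : seq entry :=
  if outer then
    [seq (size env, t) | t <- outer_traces] ++
    [seq x <- env | strict x.2 && all (fun p => (p.2.1 == x.1) ==> p.1.2) (zip ls env)]
  else [:: (size env, Free)].

Definition extensions (ls : seq link) (x : entry) (env : seq entry)
    (cols : seq (seq color)) : seq (seq color) :=
  flatten [seq [seq k :: g | k <- palette &
     allows x.2 k && all (fun p => compatible p.1 x k p.2.1 p.2.2) (zip ls (zip env g))]
    | g <- cols].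

(** Plays the game against all traces, one vertex at a time.  The list [cols]
    holds every coloring of the vertices treated so far, latest vertex first, so
    that the work on a prefix is shared by all its continuations. *)
Fixpoint extendable (rs : seq (bool * seq link)) env cols : bool :=
  if rs is r :: rs' then
    all (fun x => extendable rs' (x :: env) (extensions r.2 x env cols))
        (entries r.1 r.2 env)
  else ~~ nilp cols.

(** The search is set up from an arbitrary graph: it is run on numbers, and its
    outcome is transported to the vertices of the graph to be colored. *)
Section Rows.
Variables (V : Type) (adj sep : rel V) (deg : V -> nat) (s : seq V).

Definition link_of (v z : V) : link :=
  (adj v z, has (fun w => adj v w && adj z w) s, ~~ sep v z).
Fixpoint rows (done rest : seq V) : seq (bool * seq link) :=
  if rest is v :: rest' then
    (count (adj v) s < deg v, [seq link_of v z | z <- done])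
      :: rows (v :: done) rest'
  else [::].

(** The relation [sep] holds between vertices known to have no common neighbour
    outside [s]; a vertex has one outer neighbour exactly when its degree exceeds
    the number of its neighbours in [s]. *)
Definition reducible : bool :=
  all (fun v => deg v <= (count (adj v) s).+1) s &&
  extendable (rows [::] s) [::] [:: [::]].
End Rows.

(** * Soundness of the search *)

Section Soundness.
Variables (T : eqType) (W : eqType) (e sep : rel T) (deg : T -> nat) (s : seq T).
Variables (out : T -> option W) (tr : T -> trace).
Hypothesis e_sym : symmetric e.
Hypothesis tr_outer : {in s, forall v, (count (e v) s < deg v) = (tr v != Free)}.
Definition share v z := (out v == out z) && (out v != None).
Hypothesis share_ok : {in s &, forall v z, v != z -> share v z ->
  [/\ strict (tr v), tr v = tr z & ~~ sep v z]}.

Definition pair_ok (f : T -> color) (v z : T) : bool :=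
  (e v z ==> (f v != f z) && ~~ bars (tr v) (f z)) &&
  ((f v).1 && (has (fun w => e v w && e z w) s || share v z) ==> (f v != f z)).

Definition valid (l : seq T) (f : T -> color) : Prop :=
  {in l, forall v, allows (tr v) (f v)} /\
  {in l &, forall v z, v != z -> pair_ok f v z}.

(** The actual traces and coincidences are one branch of the search.  The
    numbers [id] follow that branch: two vertices get the same number exactly
    when they share their outer neighbour. *)
Lemma extendable_sound rest done (id : T -> nat) (cols : seq (seq color)) :
  uniq (rest ++ done) -> {subset rest ++ done <= s} ->
  {in done, forall v, id v < size done} ->
  {in done &, forall v z, v != z -> share v z = (id v == id z)} ->
  (forall g, g \in cols -> exists2 f, g = map f done & valid done f) ->
  extendable (rows e sep deg s done rest) [seq (id v, tr v) | v <- done] cols ->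
  exists f, valid (rest ++ done) f.
Proof.
have shareC v z : share v z = share z v.
  by rewrite /share eq_sym; case: eqP => //= ->.
elim: rest done id cols => [|v rest IH] done id cols /=.
  move=> _ _ _ _ colsP; case: cols colsP => // g cols colsP _.
  by have [f _ vf] := colsP g (mem_head _ _); exists f.
move=> /andP[v_new Uall] subs id_lt idP colsP /allP ext.
have{v_new} [v_rest v_done] : v \notin rest /\ v \notin done.
  by apply/andP; move: v_new; rewrite mem_cat negb_or.
have vs : v \in s by apply: subs; rewrite mem_head.
have dones u : u \in done -> u \in s.
  by move=> ud; apply: subs; rewrite inE mem_cat ud !orbT.
have vneq u : u \in done -> u != v by apply: contraTneq => ->.
pose i := if [seq z <- done | share v z] is z :: _ then id z else size done.
pose id' u := if u == v then i else id u.
have id'E : {in done, id' =1 id} by move=> u /vneq/negPf; rewrite /id' => ->.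
have iP z : z \in done -> share v z = (i == id z).
  move=> zd; rewrite /i.
  case E: [seq z <- done | share v z] => [|y l].
    have /negPf-> : ~~ share v z.
      apply/negP=> vz; have: z \in [seq z <- done | share v z].
        by rewrite mem_filter vz.
      by rewrite E.
    by apply/esym/negbTE; rewrite neq_ltn (id_lt z zd) orbT.
  have: y \in [seq z <- done | share v z] by rewrite E mem_head.
  rewrite mem_filter => /andP[vy yd].
  have -> : share v z = share y z by rewrite /share; case/andP: vy => /eqP->.
  have [<-|yz] := eqVneq y z; last exact: idP.
  by rewrite [RHS]eqxx; case/andP: vy => /eqP vy ny; rewrite /share eqxx -vy.
have x_entry : (i, tr v) \in entries
    (count (e v) s < deg v) [seq link_of e sep s v z | z <- done]
    [seq (id v, tr v) | v <- done].
  rewrite /entries tr_outer // size_map /i.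
  case E: [seq z <- done | share v z] => [|y l].
    case: ifPn => [/outer_traces_all tin|/negPn/eqP->]; last exact: mem_head.
    by rewrite mem_cat map_f.
  have: y \in [seq z <- done | share v z] by rewrite E mem_head.
  rewrite mem_filter => /andP[vy yd].
  have vy_neq : v != y by rewrite eq_sym vneq.
  have [st trE _] := share_ok vs (dones _ yd) vy_neq vy.
  case: ifPn st => [_ st|/negPn/eqP-> //]; rewrite mem_cat mem_filter st trE.
  apply/orP; right; apply/andP; split; last by apply: (map_f (fun z => (id z, tr z))).
  rewrite zip_map all_map; apply/allP => z zd /=; apply/implyP => zy.
  have vz_neq : v != z by rewrite eq_sym vneq.
  have vz : share v z.
    by rewrite (iP z zd) /i E eq_sym.
  by have [] := share_ok vs (dones _ zd) vz_neq vz.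
have cat_mem u : (u \in v :: rest ++ done) = (u \in rest ++ v :: done).
  by rewrite !(inE, mem_cat) orbCA.
have [] := IH (v :: done) id' (extensions [seq link_of e sep s v z | z <- done]
    (i, tr v) [seq (id v, tr v) | v <- done] cols).
- by rewrite uniq_catC /= mem_cat negb_or v_rest v_done uniq_catC.
- by move=> u; rewrite -cat_mem; apply: subs.
- move=> u; rewrite inE /id' => /predU1P[->|ud].
    rewrite eqxx /i ltnS.
    case E: [seq z <- done | share v z] => [|y l] //.
    have: y \in [seq z <- done | share v z] by rewrite E mem_head.
    by rewrite mem_filter => /andP[_ /id_lt/ltnW].
  by rewrite (negPf (vneq _ ud)) ltnS ltnW ?id_lt.
- move=> u w; rewrite !inE => /predU1P[->|ud] /predU1P[->|wd]; first by rewrite eqxx.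
  + by rewrite (id'E w wd) /id' eqxx iP.
  + by rewrite (id'E u ud) /id' eqxx shareC iP // eq_sym.
  + by rewrite (id'E w wd) (id'E u ud); apply: idP.
- move=> g' /flattenP[_ /mapP[g /colsP[f -> vf] ->]] /mapP[k].
  rewrite mem_filter => /andP[/andP[/= ak /allP comp] _] ->.
  pose f' u := if u == v then k else f u.
  have f'E : {in done, f' =1 f} by move=> u /vneq/negPf; rewrite /f' => ->.
  have f'v : f' v = k by rewrite /f' eqxx.
  have compP z : z \in done -> pair_ok f' v z /\ pair_ok f' z v.
    move=> zd; have vz : v != z by rewrite eq_sym vneq.
    move: comp; rewrite !zip_map => comp.
    have := comp _ (map_f (fun z => (link_of e sep s v z, ((id z, tr z), f z))) zd).
    rewrite /pair_ok /compatible /= f'v f'E // -iP // => /andP[adj cm].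
    rewrite [e z v]e_sym [share z v]shareC (eq_sym (f z)).
    have -> : has (fun w => e z w && e v w) s = has (fun w => e v w && e z w) s.
      by apply: eq_has => w; rewrite andbC.
    rewrite cm; split.
      by rewrite andbT; apply/implyP => /(implyP adj)/and3P[-> ->].
    apply/andP; split; first by apply/implyP => /(implyP adj)/and3P[-> _ ->].
    apply/implyP => /andP[fz com]; apply/eqP => kz.
    by move: cm; rewrite kz fz com eqxx.
  exists f'.
    by rewrite /= f'v; congr cons; apply/eq_in_map => u ud; rewrite f'E.
  split=> [u|u w]; rewrite !inE.
    by move=> /predU1P[->|ud]; [rewrite f'v | rewrite f'E //; apply: vf.1].
  move=> /predU1P[->|ud] /predU1P[->|wd] uw; first by rewrite eqxx in uw.
  + by case: (compP w wd).
  + by case: (compP u ud).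
  + by move: (vf.2 _ _ ud wd uw); rewrite /pair_ok !f'E.
- have -> : [seq (id' u, tr u) | u <- v :: done] =
      (i, tr v) :: [seq (id u, tr u) | u <- done].
    by rewrite /= {1}/id' eqxx; congr cons; apply/eq_in_map => u /id'E->.
  exact: ext x_entry.
move=> f [vf1 vf2]; exists f; split=> [u|u w]; rewrite !cat_mem; first exact: vf1.
exact: vf2.
Qed.
End Soundness.

(** * Transport of the search along an embedding *)

Section Transfer.
Variables (V V' : eqType) (h : V -> V') (adj sep : rel V) (adj' sep' : rel V').
Variables (deg : V -> nat) (deg' : V' -> nat) (s : seq V).
Hypothesis adjE : {in s &, forall i j, adj' (h i) (h j) = adj i j}.
Hypothesis sepE : {in s &, forall i j, sep' (h i) (h j) = sep i j}.
Hypothesis degE : {in s, forall i, deg' (h i) = deg i}.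

Lemma count_adj_map : {in s, forall v, count (adj' (h v)) (map h s) = count (adj v) s}.
Proof. by move=> v vs; rewrite count_map; apply: eq_in_count => z zs /=; apply: adjE. Qed.

Lemma rows_map done rest : {subset done <= s} -> {subset rest <= s} ->
  rows adj' sep' deg' (map h s) (map h done) (map h rest) = rows adj sep deg s done rest.
Proof.
elim: rest done => //= v rest IH done dones rests.
have vs : v \in s by apply: rests; rewrite mem_head.
rewrite count_adj_map // degE // -(IH (v :: done)); last first.
- by move=> u ud; apply: rests; rewrite inE ud orbT.
- by move=> u; rewrite inE => /predU1P[->|/dones].
congr ((_, _) :: _); rewrite -map_comp; apply/eq_in_map => z /dones zs /=.
rewrite /link_of adjE // sepE //; congr (_, _, _).
by rewrite has_map; apply: eq_in_has => w ws /=; rewrite !adjE.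
Qed.

Lemma reducible_map : reducible adj' sep' deg' (map h s) = reducible adj sep deg s.
Proof.
rewrite /reducible -(rows_map (done := [::])) // all_map.
congr (_ && _); apply: eq_in_all => v vs /=.
by rewrite degE // count_adj_map.
Qed.
End Transfer.

(** * Colorings of induced subgraphs *)

Section Graph.
Variables (T : finType) (e : rel T).
Hypothesis e_sym : symmetric e.
Implicit Types (D : {set T}) (c : T -> color).

Definition nbrs D x := [set y in D | e x y].

Lemma in_nbrs D x y : (y \in nbrs D x) = (y \in D) && e x y.
Proof. by rewrite inE. Qed.

(** Distances are those of the subgraph induced by [D]: a path through a vertex
    outside [D] does not bring two vertices to distance 2. *)
Definition packing D c : bool :=
  [forall x in D, forall y in D, (x != y) && (c x == c y) ==>
     ~~ e x y && ((c x).1 ==> [disjoint nbrs D x & nbrs D y])].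

Lemma packingP D c : reflect
  (forall x y, x \in D -> y \in D -> x != y -> c x = c y ->
     ~~ e x y /\ ((c x).1 -> forall z, z \in D -> e x z -> e y z -> False))
  (packing D c).
Proof.
apply: (iffP forall_inP) => [H x y xD yD xy cxy|H x xD].
  have /forall_inP/(_ y yD) := H x xD; rewrite xy cxy eqxx /= => /andP[-> dis].
  split=> // cx z zD xz yz; have := disjointFr (implyP dis cx) (x := z).
  by rewrite !in_nbrs zD xz yz => /(_ isT).
apply/forall_inP => y yD; apply/implyP => /andP[xy /eqP cxy].
have [-> H2] := H x y xD yD xy cxy; apply/implyP => cx.
rewrite disjoint_subset; apply/subsetP => z; rewrite !inE => /andP[zD xz].
by apply/negP => /andP[_ yz]; apply: (H2 cx z).
Qed.

Definition colorable D : bool := [exists c : {ffun T -> color}, packing D c].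

Lemma colorableP D : reflect (exists c, packing D c) (colorable D).
Proof.
apply: (iffP existsP) => [[c cP]|[c cP]]; first by exists c.
exists [ffun x => c x]; apply/packingP => x y xD yD xy; rewrite !ffunE.
by move: cP => /packingP; apply.
Qed.

Definition saturated D c := forall x, x \in D -> (c x).1 -> forall i,
  exists2 y, y \in nbrs D x & c y = near i.

(** Recoloring a far vertex with a missing near color keeps the coloring good and
    lowers the number of far vertices. *)
Lemma saturate D c : packing D c -> exists2 c', packing D c' & saturated D c'.
Proof.
have [n] := ubnP #|[set x in D | (c x).1]|; elim: n c => // n IH c le_n cP.
have [|/exists_inPn sat] := boolP [exists x in D,
    (c x).1 && [exists i, [forall y in nbrs D x, c y != near i]]]; last first.
  exists c => // x xD cx i; have := sat x xD; rewrite cx /= => /existsPn/(_ i).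
  by case/forall_inPn => y yN /negPn/eqP; exists y.
case/exists_inP => x xD /andP[cx /existsP[i /forall_inP free]].
pose c' y := if y == x then near i else c y.
have c'x : c' x = near i by rewrite /c' eqxx.
have c'E y : y != x -> c' y = c y by rewrite /c' => /negPf->.
have freeP y : y \in D -> e x y -> near i <> c y.
  by move=> yD xy; apply/eqP; rewrite eq_sym free // in_nbrs yD.
apply: (IH c').
  rewrite -ltnS (leq_trans _ le_n) // ltnS; apply: proper_card.
  apply/properP; split; last by exists x; rewrite !inE ?c'x ?xD.
  by apply/subsetP => y; rewrite !inE /c'; case: eqP => [->|_] //=; rewrite andbF.
apply/packingP => y z yD zD yz.
have [yx|yx] := eqVneq y x; have [zx|zx] := eqVneq z x.
- by rewrite yx zx eqxx in yz.
- by rewrite yx c'x c'E // => E; split=> //; apply/negP => /freeP; apply.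
- rewrite zx c'x c'E // => E; rewrite E; split=> //.
  by apply/negP; rewrite e_sym => /freeP; apply.
- by rewrite !c'E //; move/packingP: cP; apply.
Qed.

End Graph.

(** * Extending a coloring over a reducible set *)

Section Extension.
Variables (T : finType) (e : rel T).
Hypotheses (e_sym : symmetric e) (e_irr : irreflexive e).
Variable (D : {set T}) (s : seq T) (sep : rel T).
Hypothesis e_cub : {in D, forall x, #|nbrs e D x| <= 3}.
Let R := D :\: [set x in s].
Hypotheses (s_uniq : uniq s) (sD : {subset s <= D}).
Hypothesis s_red : reducible e sep (fun v => #|nbrs e D v|) s.
Hypothesis sepP : forall w a b, w \in R -> a \in s -> b \in s -> sep a b ->
  e w a -> e w b -> False.

Lemma in_rest x : (x \in R) = (x \notin s) && (x \in D).
Proof. by rewrite !inE. Qed.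

Lemma card_nbrs_rest v : #|nbrs e R v| + count (e v) s = #|nbrs e D v|.
Proof.
rewrite addnC -(cardsID [set x in s] (nbrs e D v)); congr (_ + _).
  rewrite -size_filter -(card_uniqP (filter_uniq _ s_uniq)); apply: eq_card => x.
  rewrite mem_filter !inE.
  by case: (x \in s) (@sD x) => [->|] //=; rewrite ?andbT ?andbF.
by apply: eq_card => x; rewrite !inE andbA.
Qed.

(** Hence putting [s] back brings no two vertices outside [s] to distance 2. *)
Lemma outer_unique v w w' : v \in s -> w \in nbrs e R v -> w' \in nbrs e R v -> w = w'.
Proof.
move=> vs; have /andP[/allP/(_ v vs) + _] := s_red.
by rewrite -card_nbrs_rest -add1n leq_add2r => /card_le1_eqP H wN w'N; apply: H.
Qed.

Definition outer v : option T := [pick w in nbrs e R v].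

Lemma outerP v w : v \in s -> w \in R -> e v w -> outer v = Some w.
Proof.
move=> vs wR vw; rewrite /outer; have wN : w \in nbrs e R v by rewrite in_nbrs wR.
by case: pickP => [w' w'N|/(_ w)]; [congr Some; apply: outer_unique vs _ _ | rewrite wN].
Qed.

Lemma outer_some v w : outer v = Some w -> w \in R /\ e v w.
Proof. by rewrite /outer; case: pickP => // w' + [<-]; rewrite in_nbrs => /andP[]. Qed.

Variable c : T -> color.
Hypotheses (c_packing : packing e R c) (c_sat : saturated e R c).

Definition trace_of (w : T) : trace :=
  if (c w).1 then Far (c w).2 else
  if [pick j | [forall y in nbrs e R w, c y != far j]] is Some j
  then Strict (~~ (c w).2) j else Flip.

Definition trace_at (v : T) : trace := oapp trace_of Free (outer v).

Lemma trace_of_neq w : trace_of w != Free.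
Proof. by rewrite /trace_of; case: (c w).1 => //; case: pickP. Qed.

(** Beside v, the vertex w has two neighbours outside [s] of the other kind (near
    or far): both near colors by saturation if w is far, both far colors if w
    carries [Flip].  As its degree is at most 3, it has no further neighbour. *)
Lemma loose_nbrs w v y : ~~ strict (trace_of w) -> w \in R -> v \in s -> e v w ->
  y \in D -> e w y -> y = v \/ (y \in R /\ (c y).1 = ~~ (c w).1).
Proof.
move=> loose wR vs vw yD wy; have [->|yv] := eqVneq y v; [by left|right].
have [wD vD] : w \in D /\ v \in D by move: wR; rewrite in_rest => /andP[_ ->]; rewrite sD.
have [y1 [y2 [y1N y2N y12 [c1 c2]]]] : exists y1 y2, [/\ y1 \in nbrs e R w,
    y2 \in nbrs e R w, y1 != y2 & (c y1).1 = ~~ (c w).1 /\ (c y2).1 = ~~ (c w).1].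
  move: loose; rewrite /trace_of; case: ifP => cw.
    move=> _; have [y1 y1N c1] := c_sat wR cw false.
    have [y2 y2N c2] := c_sat wR cw true; exists y1, y2; split=> //; last by rewrite c1 c2.
    by apply/eqP => E; move: c2; rewrite -E c1.
  case: pickP => // full _.
  have /forall_inPn[y1 y1N /negPn/eqP c1] := negbT (full false).
  have /forall_inPn[y2 y2N /negPn/eqP c2] := negbT (full true).
  exists y1, y2; split=> //; last by rewrite c1 c2.
  by apply/eqP => E; move: c2; rewrite -E c1.
have vR y' : y' \in nbrs e R w -> v != y'.
  by rewrite in_nbrs in_rest => /andP[/andP[ys _] _]; apply: contraNneq ys => <-.
have sub : nbrs e R w \subset nbrs e D w.
  by apply/subsetP => z; rewrite !in_nbrs in_rest => /andP[/andP[_ ->]].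
have [yE|] := boolP (y \in [set y1; y2]).
  by case/set2P: yE => ->; split=> //; move: y1N y2N; rewrite !in_nbrs => /andP[? _] /andP[? _].
rewrite !inE negb_or => /andP[n1 n2].
have: 3 < #|nbrs e D w|.
  have U : uniq [:: v; y; y1; y2].
    by rewrite /= !inE !negb_or [v == y]eq_sym yv !vR // n1 n2 y12.
  rewrite -[4]/(size [:: v; y; y1; y2]) -(card_uniqP U).
  apply/subset_leq_card/subsetP => z; rewrite !inE => /or4P[]/eqP->.
  - by rewrite vD e_sym.
  - by rewrite yD.
  - by move: (subsetP sub _ y1N); rewrite in_nbrs.
  - by move: (subsetP sub _ y2N); rewrite in_nbrs.
by rewrite ltnNge e_cub.
Qed.

Lemma shared_strict w v z : w \in R -> v \in s -> z \in s -> v != z -> e v w -> e z w ->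
  strict (trace_of w).
Proof.
move=> wR vs zs vz vw zw; apply: contraT => loose.
have := loose_nbrs loose wR vs vw (sD zs).
rewrite [e w z]e_sym => /(_ zw)[zv|[]].
  by rewrite zv eqxx in vz.
by rewrite in_rest zs.
Qed.

(** The answer of the search to the traces left by the coloring [c]. *)
Lemma extension_colors : exists f, valid e s outer trace_at s f.
Proof.
have /andP[_ red] := s_red.
have [] := extendable_sound (out := outer) (tr := trace_at) (done := [::])
  (id := fun=> 0) (cols := [:: [::]]) e_sym _ _ _ _ _ _ _ red.
- move=> v vs /=; rewrite -card_nbrs_rest -[X in X < _]add0n ltn_add2r.
  rewrite /trace_at /outer; case: pickP => [w wN|none] /=.
    by rewrite trace_of_neq; apply/card_gt0P; exists w.
  by apply/negbTE; rewrite -eqn0Ngt; apply/eqP/eq_card0.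
- move=> v z vs zs vz; rewrite /share => /andP[/eqP E].
  case ov: (outer v) => [w|] // _; have oz : outer z = Some w by rewrite -E.
  have [[wR vw] [_ zw]] := (outer_some ov, outer_some oz).
  split; first by rewrite /trace_at ov /=; apply: shared_strict vz vw zw.
    by rewrite /trace_at ov oz.
  by apply/negP => /(sepP wR vs zs); rewrite ![e w _]e_sym; apply.
- by rewrite cats0.
- by move=> u; rewrite cats0.
- by [].
- by [].
- by move=> g; rewrite inE => /eqP->; exists (fun=> near false).
by move=> f; rewrite cats0; exists f.
Qed.

(** Color [s] by the answer of the search, and let an outer vertex switch its near
    color when a neighbour in [s] has taken it.  Only vertices carrying [Flip] are
    switched; their neighbours outside are all far, so that switching two of them
    at once does no harm. *)
Lemma extend_coloring : colorable e D.
Proof.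
have [f [f_allow f_pair]] := extension_colors.
pose clash w := has (fun v => e v w && (f v == c w)) s.
pose g w := if w \in s then f w else
  if ~~ (c w).1 && clash w then near (~~ (c w).2) else c w.
have gs v : v \in s -> g v = f v by rewrite /g => ->.
have trE v w : v \in s -> w \in R -> e v w -> trace_at v = trace_of w.
  by move=> vs wR vw; rewrite /trace_at (outerP vs wR vw).
have g1 w : w \in R -> (g w).1 = (c w).1.
  by rewrite in_rest /g => /andP[/negPf-> _]; case: (c w) => [[] i] //=; case: ifP.
have far_nbr v w : v \in s -> w \in R -> e v w -> (c w).1 -> trace_at v = Far (c w).2.
  by move=> vs wR vw cw; rewrite (trE _ _ vs wR vw) /trace_of cw.
have gR w : w \in R -> g w = c w \/
    [/\ trace_of w = Flip, ~~ (c w).1, clash w & g w = near (~~ (c w).2)].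
  move=> wR; move: (wR); rewrite in_rest /g => /andP[/negPf-> _].
  case: ifP => [/andP[cw cl]|]; [right; split=> //|by left].
  have /hasP[v vs /andP[vw /eqP fv]] := cl.
  have := f_allow v vs; rewrite (trE _ _ vs wR vw) /trace_of (negPf cw).
  case: pickP => //= j _; rewrite fv (negPf cw).
  by case: (c w).2.
have gN v w : v \in s -> w \in R -> e v w -> f v != g w.
  move=> vs wR vw; have al := f_allow v vs.
  have [E|[fl cw /hasP[u us /andP[uw /eqP fu]] ->]] := gR w wR; last first.
    have uv : u = v.
      apply/eqP; apply: contraT => uv.
      by have := shared_strict wR us vs uv uw vw; rewrite fl.
    rewrite -uv fu; move: cw; by case: (c w) => [[] []].
  apply/eqP => fE; rewrite E in fE.
  have cl : clash w by apply/hasP; exists v; rewrite ?vw ?fE ?eqxx.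
  have [cw|cw] := boolP (c w).1.
    by move: al; rewrite (far_nbr v w) //= fE /far -cw -surjective_pairing eqxx.
  move: E; rewrite /g cw cl; have := wR; rewrite in_rest => /andP[/negPf-> _] /=.
  by case: (c w) cw => [[] []].
have memD x : x \in D -> x \in s \/ x \in R.
  by rewrite in_rest; case: (x \in s) => /= xD; [left|right].
have nadjRR x y : x \in R -> y \in R -> x != y -> e x y -> g x != g y.
  move=> xR yR.
  wlog: x y xR yR / g x = c x.
    move=> W xy exy; have [E|[fl cx cl _]] := gR x xR; first exact: (W x y xR yR E).
    have [E|[_ cy _ _]] := gR y yR.
      by rewrite eq_sym; apply: (W y x yR xR E); rewrite 1?eq_sym 1?e_sym.
    have /hasP[v vs /andP[vx _]] := cl.
    have loose : ~~ strict (trace_of x) by rewrite fl.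
    have [|yv|[_ c1]] := loose_nbrs loose xR vs vx _ exy.
    - by move: yR; rewrite in_rest => /andP[].
    - by move: yR; rewrite in_rest yv vs.
    by rewrite c1 cx in cy.
  move=> gx xy exy; have [gy|[fl cy cl gy]] := gR y yR.
    rewrite gx gy; apply/eqP => cxy.
    by have [] := packingP _ _ _ c_packing x y xR yR xy cxy; rewrite exy.
  have /hasP[v vs /andP[vy _]] := cl.
  have loose : ~~ strict (trace_of y) by rewrite fl.
  have [|| yv|[_ c1]] := loose_nbrs (y := x) loose yR vs vy.
  - by move: xR; rewrite in_rest => /andP[].
  - by rewrite e_sym.
  - by move: xR; rewrite in_rest yv vs.
  by rewrite gx gy; apply/eqP => E; move: c1; rewrite E cy.
(* Distance 2 between s and the rest, through a middle vertex z on either side. *)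
have far_sR v w z : v \in s -> w \in R -> z \in D -> e v z -> e w z ->
    f v = g w -> (f v).1 -> False.
  move=> vs wR zD vz wz fg fv; have cw : (c w).1 by rewrite -g1 // -fg.
  have gw : g w = c w by have [//|[_ /negPf cw']] := gR w wR; rewrite cw' in cw.
  have [zs|zR] := memD z zD.
    have vnz : v != z by apply: contraTneq vz => ->; rewrite e_irr.
    have /andP[/implyP adj _] := f_pair z v zs vs (contra_neq esym vnz).
    have /andP[_] : (f z != f v) && ~~ bars (trace_at z) (f v) by apply: adj; rewrite e_sym.
    rewrite (far_nbr z w) // 1?e_sym // fg gw /= /far -cw -surjective_pairing eqxx //.
  have wN : w \in nbrs e R z by rewrite in_nbrs wR e_sym.
  have al := f_allow v vs; rewrite (trE _ _ vs zR vz) in al.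
  have [st|loose] := boolP (strict (trace_of z)).
    move: st al; rewrite /trace_of; case: ifP => // _.
    case: pickP => // j /forall_inP/(_ w wN) cj _ /=.
    by rewrite fv => /eqP fj; move: cj; rewrite -gw -fg /far -fj -fv -surjective_pairing eqxx.
  have [||wv|[_ c1]] := loose_nbrs (y := w) loose zR vs vz.
  - by move: wR; rewrite in_rest => /andP[].
  - by rewrite e_sym.
  - by move: wR; rewrite in_rest wv vs.
  have cz : ~~ (c z).1 by rewrite -c1.
  by move: al loose; rewrite /trace_of (negPf cz); case: pickP => //= _; rewrite fv.
apply/colorableP; exists g; apply/packingP => x y xD yD xy gxy.
have [xs|xR] := memD x xD; have [ys|yR] := memD y yD.
- have /andP[/implyP adj /implyP com] := f_pair x y xs ys xy.
  rewrite !gs // in gxy *; split; first by apply/negP => /adj; rewrite gxy eqxx.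
  move=> fx z zD xz yz; have: f x != f y; last by rewrite gxy eqxx.
  apply: com; rewrite fx /=.
  have [zs|zR] := memD z zD; first by apply/orP; left; apply/hasP; exists z; rewrite ?xz.
  by apply/orP; right; rewrite /share (outerP xs zR xz) (outerP ys zR yz) eqxx.
- rewrite gs // in gxy *; split.
    by apply/negP => exy; have := gN x y xs yR exy; rewrite gxy eqxx.
  by move=> fx z zD xz yz; apply: (far_sR x y z).
- rewrite [g y]gs // in gxy; split.
    by apply/negP => exy; have := gN y x ys xR; rewrite e_sym gxy eqxx => /(_ exy).
  by rewrite gxy => fx z zD xz yz; apply: (far_sR y x z).
- split; first by apply/negP => exy; have := nadjRR x y xR yR xy exy; rewrite gxy eqxx.
  rewrite g1 // => cx z zD xz yz.
  have cy : (c y).1 by rewrite -g1 // -gxy g1.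
  have [zs|zR] := memD z zD.
    have := outer_unique zs (w := x) (w' := y); rewrite !in_nbrs xR yR ![e z _]e_sym xz yz.
    by move=> /(_ isT isT) E; rewrite E eqxx in xy.
  have gE w : w \in R -> (c w).1 -> g w = c w.
    by move=> wR cw; have [//|[_ /negPf cw']] := gR w wR; rewrite cw' in cw.
  have cxy : c x = c y by rewrite -gE // gxy gE.
  have [_] := packingP _ _ _ c_packing x y xR yR xy cxy.
  by move=> /(_ cx z zR xz yz).
Qed.
End Extension.

Lemma colorable_of_reducible (T : finType) (e : rel T) (D : {set T})
    (s : seq T) (sep : rel T) :
  symmetric e -> irreflexive e -> {in D, forall x, #|nbrs e D x| <= 3} ->
  uniq s -> {subset s <= D} -> reducible e sep (fun v => #|nbrs e D v|) s ->
  (forall w a b, w \in D :\: [set x in s] -> a \in s -> b \in s -> sep a b ->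
     e w a -> e w b -> False) ->
  colorable e (D :\: [set x in s]) -> colorable e D.
Proof.
move=> e_sym e_irr cub s_uniq sD red sepP /colorableP[c0 c0P].
have [c cP c_sat] := saturate e_sym c0P.
exact: (@extend_coloring T e e_sym e_irr D s sep cub s_uniq sD red sepP c cP c_sat).
Qed.

(** * Reducible configurations *)

(** The part of the adjacency matrix above the diagonal, which is all that has to
    be compared between an explicit list of vertices and a list of edges. *)
Fixpoint upper (V : Type) (r : rel V) (s : seq V) : seq bool :=
  if s is v :: s' then [seq r v z | z <- s'] ++ upper r s' else [::].

Lemma upper_map (V V' : eqType) (h : V -> V') (r : rel V) (r' : rel V') (s : seq V) :
  symmetric r -> symmetric r' -> upper r' (map h s) = upper r s ->
  {in s &, forall i j, i != j -> r' (h i) (h j) = r i j}.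
Proof.
move=> rC rC'; elim: s => //= v s IH /eqP; rewrite eqseq_cat ?size_map //.
rewrite -map_comp => /andP[/eqP/eq_in_map E /eqP/IH{}IH] i j.
rewrite !inE => /predU1P[->|iS] /predU1P[->|jS]; first by rewrite eqxx.
- by move=> _; apply: E.
- by move=> _; rewrite rC' rC; apply: E.
- exact: IH.
Qed.

Definition edge_in (E : seq (nat * nat)) : rel nat :=
  fun i j => (i != j) && (((i, j) \in E) || ((j, i) \in E)).

(** The vertices of the pattern are the positions in [d], their prescribed
    degrees in the ambient graph.  With [sep], two 2-vertices of the pattern are
    never given a common neighbour outside. *)
Definition reducible_pattern (d : seq nat) (E : seq (nat * nat)) (sep : bool) :=
  reducible (edge_in E) 
    (fun i j => [&& sep, i != j, nth 0 d i == 2 & nth 0 d j == 2])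
    (nth 0 d) (iota 0 (size d)).

(** The spider: a center 0 of degree 3 with a 2-neighbour 1 and two neighbours 2
    and 4 of degree 3, which have the 2-neighbours 3 and 5.  The flag tells
    whether 2 and 4 are adjacent. *)
Definition spider (b : bool) : seq (nat * nat) :=
  (if b then cons (2, 4) else id) [:: (0, 1); (0, 2); (2, 3); (0, 4); (4, 5)].

(** The spider in which the 2-neighbours 1 and 3 are the same vertex. *)
Definition triangle_spider (b : bool) : seq (nat * nat) :=
  (if b then cons (2, 3) else id) [:: (0, 1); (0, 2); (0, 3); (1, 2); (3, 4)].

(** The spider in which the 2-neighbours 3 and 5 are the same vertex. *)
Definition square_spider (b : bool) : seq (nat * nat) :=
  (if b then cons (2, 3) else id) [:: (0, 1); (0, 2); (0, 3); (2, 4); (3, 4)].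

(** If 3 and 5 had a common neighbour outside, some traces could not be answered;
    such a neighbour has two 2-neighbours, contrary to [two_unique]. *)
Lemma spider_reducible b :
  reducible_pattern [:: 3; 2; 3; 2; 3; 2] (spider b) true.
Proof. by case: b; vm_compute. Qed.

Lemma triangle_spider_reducible b :
  reducible_pattern [:: 3; 2; 3; 3; 2] (triangle_spider b) true.
Proof. by case: b; vm_compute. Qed.

Lemma square_spider_reducible b :
  reducible_pattern [:: 3; 2; 3; 3; 2] (square_spider b) true.
Proof. by case: b; vm_compute. Qed.

Section Minimal.
Variables (T : finType) (e : rel T).
Hypotheses (e_sym : symmetric e) (e_irr : irreflexive e).
Variable (D : {set T}).
Local Notation d := (fun x => #|nbrs e D x|).
Hypothesis e_cub : {in D, forall x, d x <= 3}.
Hypothesis D_min : forall D' : {set T}, D' \proper D -> colorable e D'.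
Hypothesis D_not : ~~ colorable e D.

(** Deleting the pattern leaves a smaller set, colorable by minimality.  With
    [far2], the pattern may rely on 2-vertices having no common neighbour. *)
Lemma no_pattern ds E (far2 : bool) s :
  0 < size s -> uniq s -> {subset s <= D} -> map d s = ds ->
  upper e s = upper (edge_in E) (iota 0 (size ds)) ->
  (far2 -> forall w a b, w \in D -> a \in D -> b \in D -> d a = 2 -> d b = 2 ->
     e w a -> e w b -> a = b) ->
  reducible_pattern ds E far2 -> False.
Proof.
case: s => // x0 s0; set s := _ :: _ => _ s_uniq sD dsE upE sepP red.
apply: (negP D_not).
pose sep a b := [&& far2, a != b, d a == 2 & d b == 2].
pose h := nth x0 s.
have size_ds : size ds = size s by rewrite -dsE size_map.
have sE : map h (iota 0 (size ds)) = s by rewrite size_ds map_nth_iota0 ?take_size.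
have edgeC : symmetric (edge_in E) by move=> i j; rewrite /edge_in eq_sym orbC.
have hI : {in iota 0 (size ds) &, forall i j, (h i == h j) = (i == j)}.
  by move=> i j; rewrite !mem_iota /= !add0n size_ds => ? ?; apply: nth_uniq.
have dE : {in iota 0 (size ds), forall i, d (h i) = nth 0 ds i}.
  by move=> i; rewrite mem_iota /= add0n size_ds -dsE => ?; rewrite (nth_map x0).
have ? : reducible e sep d s.
  rewrite -sE (reducible_map (adj := edge_in E) (deg := nth 0 ds)
    (sep := fun i j => [&& far2, i != j, nth 0 ds i == 2 & nth 0 ds j == 2])) //.
    move=> i j iI jI; have [->|ij] := eqVneq i j.
      by rewrite e_irr /edge_in eqxx.
    by apply: (upper_map edgeC e_sym _ iI jI ij); rewrite sE.
  by move=> i j iI jI; rewrite /sep hI // !dE.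
apply: (@colorable_of_reducible T e D s sep) => //.
- move=> w a b; rewrite !inE => /andP[_ wD] /sD aD /sD bD.
  case/and4P=> fl ab /eqP da /eqP db wa wb.
  by move: ab; rewrite (sepP fl w a b wD aD bD da db wa wb) eqxx.
- apply: D_min; apply/properP; split; first exact: subsetDl.
  by exists x0; rewrite ?sD ?inE ?eqxx.
Qed.

Lemma deg_gt1 x : x \in D -> 1 < d x.
Proof.
move=> xD; rewrite ltnNge; apply/negP => d1.
apply: (@no_pattern [:: d x] [::] false [:: x]) => //.
  by move=> z; rewrite inE => /eqP->.
by case: (d x) d1 => [|[|]]; vm_compute.
Qed.

Lemma deg_cases x : x \in D -> d x = 2 \/ d x = 3.
Proof. by move=> xD; have := deg_gt1 xD; have := e_cub xD; case: #|_| => [|[|[|[|]]]]; auto. Qed.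

(** The path on two 2-vertices is reducible. *)
Lemma twos_not_adjacent x y : x \in D -> y \in D -> d x = 2 -> d y = 2 -> e x y = false.
Proof.
move=> xD yD dx dy; apply/negP => xy.
apply: (@no_pattern [:: 2; 2] [:: (0, 1)] false [:: x; y]) => //.
- by rewrite /= inE andbT; apply: contraTneq xy => ->; rewrite e_irr.
- by move=> z; rewrite !inE => /orP[]/eqP->.
- by rewrite /= dx dy.
- by rewrite /= xy.
Qed.

(** The path on three vertices with 2-vertices at both ends is reducible. *)
Lemma two_unique w a b : w \in D -> a \in D -> b \in D -> d a = 2 -> d b = 2 ->
  e w a -> e w b -> a = b.
Proof.
move=> wD aD bD da db wa wb; apply/eqP; apply: contraT => ab.
have [dw|dw] := deg_cases wD; first by rewrite twos_not_adjacent in wa.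
exfalso; apply: (@no_pattern [:: 3; 2; 2] [:: (0, 1); (0, 2)] false [:: w; a; b]) => //.
- rewrite /= !inE negb_or ab !andbT; apply/andP; split.
    by apply: contraTneq wa => ->; rewrite e_irr.
  by apply: contraTneq wb => ->; rewrite e_irr.
- by move=> z; rewrite !inE => /or3P[]/eqP->.
- by rewrite /= dw da db.
- by rewrite /= wa wb twos_not_adjacent.
Qed.

Section Spider.
Variables x v y y' : T.
Hypotheses (xD : x \in D) (vD : v \in D) (yD : y \in D) (yD' : y' \in D).
Hypotheses (dx : d x = 3) (dv : d v = 2) (dy : d y = 3) (dy' : d y' = 3).
Hypotheses (xv : e x v) (xy : e x y) (xy' : e x y') (yy' : y != y').

Lemma deg_neq a b : d a = 2 -> d b = 3 -> (a == b) = false.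
Proof. by move=> da db; apply/eqP => ab; rewrite ab db in da. Qed.

Lemma adj_neq a b : e a b -> (a == b) = false.
Proof. by move=> ab; apply: contraTF ab => /eqP->; rewrite e_irr. Qed.

Lemma not_adj_other w a b : w \in D -> a \in D -> b \in D -> d a = 2 -> d b = 2 ->
  e w a -> a != b -> e w b = false.
Proof.
by move=> wD aD bD da db wa ab; apply: contraNF ab => /(two_unique wD aD bD da db wa)/eqP.
Qed.

(** The spider in which x and y have the same 2-neighbour v. *)
Lemma no_triangle u : u \in D -> d u = 2 -> e y v -> e y' u -> False.
Proof.
move=> uD du yv yu'; have vu : v != u.
  apply/eqP => vu; have U : uniq [:: x; y; y'].
    by rewrite /= !inE (adj_neq xy) (adj_neq xy') yy'.
  have: size [:: x; y; y'] <= d v.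
    rewrite -(card_uniqP U) subset_leq_card //; apply/subsetP => z.
    by rewrite !inE => /or3P[]/eqP->; rewrite ?xD ?yD ?yD' e_sym // vu.
  by rewrite dv.
apply: (@no_pattern [:: 3; 2; 3; 3; 2] (triangle_spider (e y y')) true
  [:: x; v; y; y'; u]) => //.
- rewrite /= !inE !negb_or (adj_neq xv) (adj_neq xy) (adj_neq xy') vu yy'.
  by rewrite [x == u]eq_sym [y == u]eq_sym [y' == u]eq_sym !deg_neq.
- by move=> z; rewrite !inE => /orP[|/or4P[]]/eqP->.
- by rewrite /= dx dv dy dy' du.
- have v'y : e v y' = false by rewrite e_sym (@not_adj_other y' u) // eq_sym.
  rewrite /= xv xy xy' (@not_adj_other x v u) // [e v y]e_sym yv v'y twos_not_adjacent //.
  by rewrite (@not_adj_other y v u) // yu'; case: (e y y').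
- by move=> _; apply: two_unique.
- exact: triangle_spider_reducible.
Qed.
End Spider.

(** The two earlier exclusions determine all edges of the spider but the one
    between y and y', and leave two possible coincidences: one of the legs ends
    in v, or both legs end in the same vertex. *)
Lemma no_spider x v y u y' u' : x \in D -> v \in D -> y \in D -> u \in D ->
    y' \in D -> u' \in D ->
  d x = 3 -> d v = 2 -> d y = 3 -> d u = 2 -> d y' = 3 -> d u' = 2 ->
  e x v -> e x y -> e y u -> e x y' -> e y' u' -> y = y'.
Proof.
move=> xD vD yD uD yD' uD' dx dv dy du dy' du' xv xy yu xy' yu'.
apply/eqP; apply: contraT => yy'; exfalso.
have [vu|vu] := eqVneq v u.
  by apply: (@no_triangle x v y y' _ _ _ _ _ _ _ _ _ _ _ _ u'); rewrite // vu.
have [vu'|vu'] := eqVneq v u'.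
  by apply: (@no_triangle x v y' y _ _ _ _ _ _ _ _ _ _ _ _ u); rewrite // 1?eq_sym // vu'.
have vy : e v y = false by rewrite e_sym (@not_adj_other y u) // eq_sym.
have vy' : e v y' = false by rewrite e_sym (@not_adj_other y' u') // eq_sym.
have [uu'|uu'] := eqVneq u u'.
  subst u'; apply: (@no_pattern [:: 3; 2; 3; 3; 2] (square_spider (e y y')) true
    [:: x; v; y; y'; u]) => //.
  - rewrite /= !inE !negb_or (adj_neq xv) (adj_neq xy) (adj_neq xy') vu yy'.
    by rewrite [x == u]eq_sym (adj_neq yu) (adj_neq yu') !deg_neq.
  - by move=> z; rewrite !inE => /orP[|/or4P[]]/eqP->.
  - by rewrite /= dx dv dy dy' du.
  - rewrite /= xv xy xy' (@not_adj_other x v u) // vy vy' twos_not_adjacent //.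
    by rewrite yu yu'; case: (e y y').
  - by move=> _; apply: two_unique.
  - exact: square_spider_reducible.
apply: (@no_pattern [:: 3; 2; 3; 2; 3; 2] (spider (e y y')) true
  [:: x; v; y; u; y'; u']) => //.
- rewrite /= !inE !negb_or (adj_neq xv) (adj_neq xy) (adj_neq xy') (adj_neq yu).
  rewrite (adj_neq yu') [x == u]eq_sym [x == u']eq_sym [y == u']eq_sym.
  by rewrite vu vu' yy' uu' !deg_neq.
- by move=> z; rewrite !inE => /orP[|/orP[|/or4P[]]]/eqP->.
- by rewrite /= dx dv dy dy' du du'.
- have xu : e x u = false by rewrite (@not_adj_other x v).
  have xu' : e x u' = false by rewrite (@not_adj_other x v).
  have uy' : e u y' = false by rewrite e_sym (@not_adj_other y' u') // eq_sym.
  have yu'F : e y u' = false by rewrite (@not_adj_other y u).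
  rewrite /= xv xy xu xy' xu' vy vy' yu yu'F uy' yu'.
  rewrite (@twos_not_adjacent v u) // (@twos_not_adjacent v u') //.
  by rewrite (@twos_not_adjacent u u') //; case: (e y y').
- by move=> _; apply: two_unique.
- exact: spider_reducible.
Qed.

End Minimal.

(** * Counting edges in a minimal set without coloring *)

Section Discharging.
Variables (T : finType) (e : rel T).
Hypotheses (e_sym : symmetric e) (e_irr : irreflexive e).

Lemma sum_nbrsC (A B : {set T}) :
  \sum_(x in A) #|nbrs e B x| = \sum_(y in B) #|nbrs e A y|.
Proof.
have sumE (C D : {set T}) : \sum_(x in C) #|nbrs e D x| = \sum_(x in C) \sum_(y in D) e x y.
  apply: eq_bigr => x _; rewrite -sum1_card big_mkcond [RHS]big_mkcond /=.
  by apply: eq_bigr => y _; rewrite in_nbrs; case: (y \in D); case: (e x y).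
rewrite !sumE exchange_big /=; apply: eq_bigr => y _.
by apply: eq_bigr => x _; rewrite e_sym.
Qed.

Section MinimalCount.
Variable D : {set T}.
Hypothesis e_cub : {in D, forall x, #|nbrs e D x| <= 3}.
Hypothesis D_min : forall D' : {set T}, D' \proper D -> colorable e D'.
Hypothesis D_not : ~~ colorable e D.

Let two := [set x in D | #|nbrs e D x| == 2].
Let three := [set x in D | #|nbrs e D x| == 3].
Let close := [set x in three | [exists a in two, e x a]].
Let distant := three :\: close.

Lemma in_two x : (x \in two) = (x \in D) && (#|nbrs e D x| == 2).
Proof. by rewrite inE. Qed.
Lemma in_three x : (x \in three) = (x \in D) && (#|nbrs e D x| == 3).
Proof. by rewrite inE. Qed.

Lemma D_two : D :&: two = two.
Proof. by apply/setIidPr/subsetP => x; rewrite in_two => /andP[]. Qed.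

Lemma D_three : D :\: two = three.
Proof.
apply/setP => x; rewrite !inE; case xD: (x \in D); rewrite ?andbF //= andbT.
by have [->|->] := deg_cases e_sym e_irr e_cub D_min D_not xD.
Qed.

(** Each 2-vertex has two neighbours, both close, and each close vertex has only
    one 2-neighbour. *)
Lemma card_close : #|close| = 2 * #|two|.
Proof.
have inner a : a \in two -> #|nbrs e close a| = 2.
  rewrite in_two => /andP[aD /eqP da]; rewrite -da; apply: eq_card => x.
  rewrite !in_nbrs; case xD: (x \in D) => /=; last by rewrite !inE xD.
  case ax: (e a x); rewrite ?andbF // andbT.
  have [dx|dx] := deg_cases e_sym e_irr e_cub D_min D_not xD.
    by rewrite (twos_not_adjacent e_sym e_irr e_cub D_min D_not aD xD da dx) in ax.
  rewrite !inE xD dx eqxx /=; apply/exists_inP; exists a; rewrite ?inE ?aD ?da //.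
  by rewrite e_sym.
have outer x : x \in close -> #|nbrs e two x| = 1.
  rewrite inE in_three => /andP[/andP[xD _] /exists_inP[a]].
  rewrite in_two => /andP[aD /eqP da] xa; apply/eqP/cards1P; exists a.
  apply/setP => b; rewrite in_nbrs in_two inE; apply/idP/eqP => [|->].
    case/andP=> /andP[bD /eqP db] xb.
    by rewrite (two_unique e_sym e_irr e_cub D_min D_not xD aD bD).
  by rewrite aD da xa.
rewrite mulnC -sum1_card -sum_nat_const -(eq_bigr _ inner) sum_nbrsC.
by apply: eq_bigr => x /outer->.
Qed.

(** Beside its 2-neighbour, a close vertex has two neighbours of degree 3; by
    [no_spider] they are not both close. *)
Lemma close_nbrs x : x \in close -> 0 < #|nbrs e distant x|.
Proof.
rewrite inE in_three => /andP[/andP[xD /eqP dx]] /exists_inP[v].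
rewrite in_two => /andP[vD /eqP dv] xv; rewrite lt0n; apply/eqP => none.
have noneF z : z \in distant -> e x z = false.
  move=> zd; apply/negP => xz; have: z \in nbrs e distant x by rewrite in_nbrs zd.
  by move/eqP: none; rewrite cards_eq0 => /eqP->; rewrite inE.
have three_nbr z : z \in nbrs e D x -> z != v -> [/\ z \in D, #|nbrs e D z| = 3, e x z &
    exists u, [/\ u \in D, #|nbrs e D u| = 2 & e z u]].
  rewrite in_nbrs => /andP[zD xz] zv.
  have [dz|dz] := deg_cases e_sym e_irr e_cub D_min D_not zD.
    by move: zv; rewrite (two_unique e_sym e_irr e_cub D_min D_not xD zD vD dz dv xz xv) eqxx.
  have : z \in close.
    apply: contraTT xz => zc; rewrite noneF //.
    by rewrite /distant inE zc in_three zD dz.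
  rewrite inE => /andP[_ /exists_inP[u]]; rewrite in_two => /andP[uD /eqP du] zu.
  by split=> //; exists u.
have vN : v \in nbrs e D x by rewrite in_nbrs vD.
have: 1 < #|nbrs e D x :\ v| by have := cardsD1 v (nbrs e D x); rewrite dx vN add1n => -[<-].
case/card_gt1P=> y [y' []]; rewrite !in_setD1 => /andP[yv yN] /andP[yv' yN'].
have [yD dy xy [u [uD du yu]]] := three_nbr y yN yv.
have [yD' dy' xy' [u' [uD' du' yu']]] := three_nbr y' yN' yv'.
rewrite (no_spider e_sym e_irr e_cub D_min D_not xD vD yD uD yD' uD' dx dv dy du dy' du'
  xv xy yu xy' yu') eqxx //.
Qed.

Lemma card_close_distant : #|close| <= 3 * #|distant|.
Proof.
rewrite mulnC -sum_nat_const -sum1_card.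
apply: leq_trans (leq_sum _ (fun x (xc : x \in close) => close_nbrs xc)) _.
rewrite sum_nbrsC; apply: leq_sum => y; rewrite !inE => /andP[_ /andP[yD _]].
apply: leq_trans (e_cub yD); apply/subset_leq_card/subsetP => z.
by rewrite !inE -!andbA => /and4P[-> _ _ ->].
Qed.

(** Twice the number of 2-vertices is the number of close vertices, which is at
    most three times the number of distant ones. *)
Lemma dense : 30 * #|D| <= 11 * \sum_(x in D) #|nbrs e D x|.
Proof.
rewrite -(cardsID two D) (big_setID two) /= D_two D_three.
have -> : \sum_(x in two) #|nbrs e D x| = #|two| * 2.
  by rewrite -sum_nat_const; apply: eq_bigr => x; rewrite in_two => /andP[_ /eqP].
have -> : \sum_(x in three) #|nbrs e D x| = #|three| * 3.
  by rewrite -sum_nat_const; apply: eq_bigr => x; rewrite in_three => /andP[_ /eqP].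
rewrite -(cardsID close three).
have -> : three :&: close = close by apply/setIidPr/subsetP => x; rewrite inE => /andP[].
have := card_close; have := card_close_distant; rewrite -/distant; lia.
Qed.
End MinimalCount.

Lemma sparse_colorable (D : {set T}) :
  (forall x, #|nbrs e setT x| <= 3) ->
  (forall H : {set T}, H != set0 -> 11 * \sum_(x in H) #|nbrs e H x| < 30 * #|H|) ->
  colorable e D.
Proof.
move=> cub sparse; have [n] := ubnP #|D|; elim: n D => // n IH D; rewrite ltnS => le_n.
apply: contraT => D_not.
have D_min (D' : {set T}) : D' \proper D -> colorable e D'.
  by move=> /proper_card lt; apply: IH; apply: leq_trans lt le_n.
have e_cub : {in D, forall x, #|nbrs e D x| <= 3}.
  move=> x _; apply: leq_trans (cub x); apply/subset_leq_card/subsetP => y.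
  by rewrite !inE => /andP[].
have := dense e_cub D_min D_not; rewrite leqNgt sparse //.
apply: contraNneq D_not => ->; apply/colorableP; exists (fun=> near false).
by apply/packingP => x y; rewrite inE.
Qed.

(** * The maximum average degree and distances *)

(** Handshake: both sides count the pairs of a vertex of [D] and an edge at it. *)
Lemma sum_degrees (D : {set T}) :
  \sum_(x in D) #|nbrs e D x| = 2 * #|[set A in edges e | A \subset D]|.
Proof.
set F := [set A in _ | _].
have F2 A : A \in F -> exists x y, [/\ x \in D, y \in D, e x y & A = [set x; y]].
  rewrite inE => /andP[/imsetP[[x y]]]; rewrite inE /= => xy -> /subsetP sub.
  by exists x, y; rewrite !sub ?set21 ?set22.
have e_neq x y : e x y -> x != y by apply: contraTneq => ->; rewrite e_irr.
transitivity (\sum_(x in D) \sum_(A in F) (x \in A)).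
  apply: eq_bigr => x xD; rewrite -big_mkcondr /= sum1dep_card.
  have <- : [set [set x; y] | y in nbrs e D x] = [set A | (A \in F) && (x \in A)].
    apply/setP => A; rewrite inE; apply/imsetP/andP.
      move=> [y]; rewrite in_nbrs => /andP[yD xy] ->; rewrite set21; split=> //.
      rewrite inE; apply/andP; split.
        by apply/imsetP; exists (x, y); rewrite ?inE.
      by apply/subsetP => z /set2P[]->.
    move=> [/F2[u [w [uD wD uw ->]]]] /set2P[->|->].
      by exists w; rewrite ?in_nbrs ?wD.
    by exists u; rewrite ?in_nbrs ?uD 1?e_sym // setUC.
  rewrite card_in_imset // => y z; rewrite !in_nbrs => /andP[_ xy] /andP[_ xz] E.
  have: y \in [set x; z] by rewrite -E set22.
  by case/set2P => // yx; move: (e_neq _ _ xy); rewrite yx eqxx.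
rewrite exchange_big /= mulnC -sum_nat_const; apply: eq_bigr => A /F2[x [y [xD yD xy ->]]].
rewrite -big_mkcondr /= sum1dep_card -(_ : #|[set x; y]| = 2); last by rewrite cards2 e_neq.
apply: eq_card => z; rewrite !inE; case: eqP => [->|_] /=; rewrite ?xD //.
by case: eqP => [->|_]; rewrite ?yD ?andbF.
Qed.

Lemma sparse_of_mad (H : {set T}) : (mad e < 30%:R / 11%:R :> rat)%R -> H != set0 ->
  11 * \sum_(x in H) #|nbrs e H x| < 30 * #|H|.
Proof.
move=> mad_lt H0; rewrite sum_degrees; set F := [set A in _ | _].
have sub : is_subgraph e (H, F) && ((H, F).1 != set0).
  rewrite /is_subgraph /= H0 andbT; apply/andP; split.
    by apply/subsetP => A; rewrite inE => /andP[].
  by apply/forall_inP => A; rewrite inE => /andP[].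
have := le_lt_trans (le_bigmax_cond 0%R (fun H : {set T} * {set {set T}} =>
  ((2 * #|H.2|)%:R / #|H.1|%:R)%R) sub) mad_lt.
rewrite /= ltr_pdivrMr ?ltr0n ?card_gt0 // mulrAC ltr_pdivlMr ?ltr0n // -!natrM ltr_nat.
by rewrite mulnC.
Qed.

(** Vertices in one component are joined by a walk without repetition, so the
    search for a shortest walk below #|T| succeeds. *)
Lemma dist_geq_of_walks x y n :
  (forall m, m < n -> ~~ walk_of_length e x y m) -> dist_geq (dist e x y) n.
Proof.
move=> far; rewrite /dist; case: ifP => //= /connectP[p /shortenP[q eq Uq _] yE].
have w_lt : size q < #|T|.
  by rewrite -[_.+1]/(size (x :: q)) -(card_uniqP Uq) max_card.
have has_walk : has (walk_of_length e x y) (iota 0 #|T|).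
  apply/hasP; exists (size q); first by rewrite mem_iota.
  by apply/existsP; exists (in_tuple q); rewrite eq yE eqxx.
rewrite leqNgt; apply/negP => /far/negP; apply.
by have := nth_find 0 has_walk; rewrite nth_iota // -[X in _ < X](size_iota 0) -has_find.
Qed.

End Discharging.

(** The near colors become the classes 0 and 1, the far ones 2 and 3. *)
Definition class_of (k : color) : 'I_4 := inord (k.1.*2 + k.2).

Lemma class_of_inj : injective class_of.
Proof. by move=> [[] []] [[] []] /(congr1 (@nat_of_ord _)); rewrite !inordK. Qed.

Lemma packing_colorable_of_colorable (T : finType) (e : rel T) :
  symmetric e -> colorable e setT -> packing_colorable e [tuple 1; 1; 2; 2].
Proof.
move=> e_sym /colorableP[c /packingP cP]; exists [ffun x => class_of (c x)].
move=> i x y; rewrite !ffunE => <- /class_of_inj cxy xy.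
have [nadj nfar] := cP x y (in_setT _) (in_setT _) xy (esym cxy).
have w0 : ~~ walk_of_length e x y 0.
  by apply/existsP => -[p]; rewrite tuple0 /= => /eqP E; rewrite E eqxx in xy.
have w1 : ~~ walk_of_length e x y 1.
  apply/existsP => -[[[|z []] // sz]] /=; rewrite andbT => /andP[xz /eqP zy].
  by rewrite -zy xz in nadj.
have w2 : (c x).1 -> ~~ walk_of_length e x y 2.
  move=> cx; apply/existsP => -[[[|z [|t []]] // sz]] /=.
  rewrite andbT -andbA => /and3P[xz zt /eqP ty].
  by apply: (nfar cx z (in_setT _) xz); rewrite e_sym -ty.
apply: dist_geq_of_walks => m; rewrite /class_of.
move: w2; case: (c x) => [[] []] /= w2; rewrite (tnth_nth 0) /= inordK //=;
  by case: m => [|[|[|m]]] //; rewrite w2.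
Qed.

Theorem theorem1p3 (T : finType) (e : rel T)
  (e_sym : symmetric e) (e_irr : irreflexive e)
  (e_subcubic : subcubic e) (e_mad : (mad e < 30%:R / 11%:R :> rat)%R) :
  packing_colorable e [tuple 1; 1; 2; 2].
Proof.
apply: packing_colorable_of_colorable => //; apply: sparse_colorable => // [x|H].
  apply: leq_trans (e_subcubic x); apply/subset_leq_card/subsetP => y.
  by rewrite !inE.
exact: sparse_of_mad.
Qed.
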